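(* Let $2\le k<n$ be integers and let $G$ be a rank-1 feature graph on $[n]$ with non-negative edge weights, given by scalar features $f_1,\dots,f_n\in\mathbb{R}_+$ with $w_{ij}=f_if_j$ for $i\ne j$. Let $\mathcal{A}^{\mathrm{ALG}}$ be the partition of $[n]$ returned by the Greedy Feature-Balancing Algorithm on input $f_1,\dots,f_n$ and $k$, let $\mathrm{ALG}:=\operatorname{Cut}(\mathcal{A}^{\mathrm{ALG}})$, let $\mathcal{A}^*$ be an optimal partition for Max-$k$-Cut on $G$, let $\mathrm{OPT}=\operatorname{Cut}(\mathcal{A}^* )$, and write $\Phi^{\mathrm{ALG}}:=\Phi(\mathcal{A}^{\mathrm{ALG}})$ and $\Phi^*:=\Phi(\mathcal{A}^* )$. Let $\alpha\ge1$ be a worst-case constant for the greedy rule on the sum-of-squares partition problem, i.e. $\Phi^{\mathrm{ALG}}\le\alpha\,\Phi^*$ for every instance. Then $$\mathrm{OPT}-\mathrm{ALG}\ \le\ \frac{\alpha-1}{2\alpha}\,\Phi^{\mathrm{ALG}}.$$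
   Context: $[n]=\{1,\dots,n\}$ and $\mathbb{R}_+$ denotes the non-negative reals. A rank-1 feature graph is a weighted graph on $[n]$ whose weights can be written as $w_{ij}=f_if_j$ for all $i\ne j$ with real scalars $f_1,\dots,f_n$ (with $w_{ij}=0$ for non-edges). For a partition $\mathcal{A}=(A_1,\dots,A_k)$ of $[n]$ into $k$ disjoint (possibly empty) parts, $$\operatorname{Cut}(\mathcal{A})=\sum_{\ell<m}\sum_{i\in A_\ell,\,j\in A_m}w_{ij},\qquad \Phi(\mathcal{A})=\sum_{\ell=1}^k\Big(\sum_{i\in A_\ell}f_i\Big)^2.$$ Max-$k$-Cut asks to maximize $\operatorname{Cut}$. The sum-of-squares partition problem asks, given non-negative numbers $f_1,\dots,f_n$ and $k$, for a partition minimizing $\Phi$; an instance consists of such numbers and $k$. Greedy Feature-Balancing Algorithm for scalar features: choose an ordering $(v_1,\dots,v_n)$ of $[n]$ with $|f_{v_1}|\ge\cdots\ge|f_{v_n}|$ (ties broken arbitrarily). Start with $A_1=\cdots=A_k=\emptyset$ and $s_1=\cdots=s_k=0$. For $t=1,\dots,n$: let $v=v_t$; choose $\ell^\star\in\arg\min_{\ell\in[k]}f_vs_\ell$ (ties broken arbitrarily); replace $A_{\ell^\star}$ by $A_{\ell^\star}\cup\{v\}$ and $s_{\ell^\star}$ by $s_{\ell^\star}+f_v$. Return $(A_1,\dots,A_k)$. *)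

(* Defs.v *)
From mathcomp Require Import all_boot all_order all_algebra.
From mathcomp Require Import reals.

Set Implicit Arguments.
Unset Strict Implicit.
Unset Printing Implicit Defensive.

Import Order.TTheory GRing.Theory Num.Theory.
Local Open Scope ring_scope.

(* The vertex set [n] is 'I_n and the k labels are 'I_k. *)

Record wgraph (R : realType) (n : nat) := WGraph {
  edge : rel 'I_n;
  weight : 'I_n -> 'I_n -> R;
  edge_sym : symmetric edge;
  edge_irr : irreflexive edge;
  weight_sym : forall i j, weight i j = weight j i;
  weight_nonedge : forall i j, ~~ edge i j -> weight i j = 0
}.

(* The condition does not mention [edge]: [weight_nonedge] then forces
   f i * f j = 0 on every pair of distinct non-adjacent vertices. *)
Definition rank1_features (R : realType) (n : nat) (G : wgraph R n)
    (f : 'I_n -> R) : Prop :=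
  forall i j : 'I_n, i != j -> weight G i j = f i * f j.

(* Not [finset.partition]: parts are labelled and may be empty. *)
Definition kpartition (n k : nat) (A : {ffun 'I_k -> {set 'I_n}}) : Prop :=
  (forall l m : 'I_k, l != m -> [disjoint A l & A m]) /\
  \bigcup_(l < k) A l = [set: 'I_n].

Definition cut (R : realType) (n k : nat) (G : wgraph R n)
    (A : {ffun 'I_k -> {set 'I_n}}) : R :=
  \sum_(l < k) \sum_(m < k | (l < m)%N)
    \sum_(i in A l) \sum_(j in A m) weight G i j.

Definition sumsq (R : realType) (n k : nat) (f : 'I_n -> R)
    (A : {ffun 'I_k -> {set 'I_n}}) : R :=
  \sum_(l < k) (\sum_(i in A l) f i) ^+ 2.

Definition max_kcut (R : realType) (n k : nat) (G : wgraph R n)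
    (A : {ffun 'I_k -> {set 'I_n}}) : Prop :=
  kpartition A /\
  forall B : {ffun 'I_k -> {set 'I_n}}, kpartition B -> cut G B <= cut G A.

Definition min_sumsq (R : realType) (n k : nat) (f : 'I_n -> R)
    (A : {ffun 'I_k -> {set 'I_n}}) : Prop :=
  kpartition A /\
  forall B : {ffun 'I_k -> {set 'I_n}},
    kpartition B -> sumsq f A <= sumsq f B.

(* The parts A_1, ..., A_k together with the running sums s_1, ..., s_k. *)
Definition gstate (R : realType) (n k : nat) : Type :=
  ({ffun 'I_k -> {set 'I_n}} * {ffun 'I_k -> R})%type.

Definition greedy_init (R : realType) (n k : nat) : gstate R n k :=
  ([ffun _ => set0], [ffun _ => 0]).

Definition greedy_put (R : realType) (n k : nat) (f : 'I_n -> R)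
    (st : gstate R n k) (v : 'I_n) (l : 'I_k) : gstate R n k :=
  ([ffun m => if m == l then v |: st.1 m else st.1 m],
   [ffun m => if m == l then st.2 m + f v else st.2 m]).

(* Ties are broken arbitrarily, so the algorithm is nondeterministic: it is
   given as a relation between initial and final states. *)
Inductive greedy_run (R : realType) (n k : nat) (f : 'I_n -> R) :
    seq 'I_n -> gstate R n k -> gstate R n k -> Prop :=
| greedy_done (st : gstate R n k) : greedy_run f [::] st st
| greedy_step (v : 'I_n) (vs : seq 'I_n) (st st' : gstate R n k) (l : 'I_k) :
    (forall m : 'I_k, f v * st.2 l <= f v * st.2 m) ->
    greedy_run f vs (greedy_put f st v l) st' ->
    greedy_run f (v :: vs) st st'.

Definition greedy_order (R : realType) (n : nat) (f : 'I_n -> R)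
    (vs : seq 'I_n) : Prop :=
  perm_eq vs (enum 'I_n) /\ sorted (fun i j => `|f j| <= `|f i|) vs.

(* [A] is a possible output, for some way of breaking the ties. *)
Definition greedy_output (R : realType) (n k : nat) (f : 'I_n -> R)
    (A : {ffun 'I_k -> {set 'I_n}}) : Prop :=
  exists (vs : seq 'I_n) (s : {ffun 'I_k -> R}),
    greedy_order f vs /\ greedy_run f vs (greedy_init R n k) (A, s).

(* The bound must hold for all sizes n, k and all tie-breakings. *)
Definition greedy_sumsq_constant (R : realType) (alpha : R) : Prop :=
  forall (n k : nat) (f : 'I_n -> R) (A B : {ffun 'I_k -> {set 'I_n}}),
    (0 < k)%N -> (forall i, 0 <= f i) ->
    greedy_output f A -> min_sumsq f B ->
    sumsq f A <= alpha * sumsq f B.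

(* Main.v *)
(** On a rank-1 graph, expanding the square of the total feature mass shows
    that 2 Cut(A) + Phi(A) is the same for every partition A.  Hence an optimal
    cut minimizes Phi, and
    OPT - ALG = (Phi_ALG - Phi_OPT) / 2, where Phi_OPT >= Phi_ALG / alpha. *)

Require Import Defs.
From mathcomp Require Import all_boot all_order all_algebra.
From mathcomp Require Import reals.
From mathcomp Require Import ring lra.

Set Implicit Arguments.
Unset Strict Implicit.
Unset Printing Implicit Defensive.

Import Order.TTheory GRing.Theory Num.Theory.
Local Open Scope ring_scope.

(** The double sum splits into the diagonal and two triangles; exchanging the indices maps one
    triangle onto the other, whence the factor 2. *)
Lemma sqr_sum_ord (R : comPzRingType) (k : nat) (S : 'I_k -> R) :
  (\sum_l S l) ^+ 2 =
  \sum_l S l ^+ 2 + (\sum_(l < k) \sum_(m < k | (l < m)%N) S l * S m) *+ 2.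
Proof.
rewrite expr2 big_distrlr /= mulr2n.
have -> : \sum_l \sum_m S l * S m =
    \sum_(l < k) (S l ^+ 2 + (\sum_(m < k | (l < m)%N) S l * S m +
                        \sum_(m < k | (m < l)%N) S l * S m)).
  apply: eq_bigr => l _; rewrite (bigD1 l) //= expr2; congr (_ + _).
  rewrite (bigID (fun m : 'I_k => (l < m)%N)) /=.
  congr (_ + _); apply: eq_bigl => m; rewrite -val_eqE /=;
    by case: (ltngtP m l).
rewrite !big_split /=; congr (_ + (_ + _)).
rewrite (exchange_big_dep predT) //=.
by apply: eq_bigr => l _; apply: eq_bigr => m _; rewrite mulrC.
Qed.

(** Uniqueness of the label [m] gives disjointness, its existence gives covering. This
    vertex-by-vertex form suits induction along a greedy run. *)
Lemma kpartition_label (n k : nat) (A : {ffun 'I_k -> {set 'I_n}}) :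
  (forall i, exists m, forall l, (i \in A l) = (l == m)) -> kpartition A.
Proof.
move=> labelA; split=> [l m neq_lm|].
  apply/pred0P => i /=; have [p Ap] := labelA i; rewrite !Ap.
  by apply: contraNF neq_lm => /andP[/eqP-> /eqP->].
apply/setP => i; rewrite in_setT; have [p Ap] := labelA i.
by apply/bigcupP; exists p; rewrite ?Ap.
Qed.

Section Greedy.
Variables (R : realType) (n k : nat) (f : 'I_n -> R).
Implicit Types (vs : seq 'I_n) (st : gstate R n k).

Lemma greedy_put_in st v i l m :
  (i \in (greedy_put f st v l).1 m) = (m == l) && (i == v) || (i \in st.1 m).
Proof. by rewrite ffunE; case: eqP => //= _; rewrite in_setU1. Qed.

Lemma greedy_run_notin vs st st' i : greedy_run f vs st st' -> i \notin vs ->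
  forall l, (i \in st'.1 l) = (i \in st.1 l).
Proof.
elim=> {vs st st'} // v vs st st' l _ _ IH.
rewrite inE negb_or => /andP[/negbTE neq_iv /IH Hi] m.
by rewrite Hi greedy_put_in neq_iv andbF.
Qed.

(** Induction on the run: the step that treats [i] puts it into a single part, and since [vs] has no
    repetition, no later step moves it. *)
Lemma greedy_run_label vs st st' i : greedy_run f vs st st' -> uniq vs ->
    i \in vs -> (forall l, i \notin st.1 l) ->
  exists m, forall l, (i \in st'.1 l) = (l == m).
Proof.
elim=> {vs st st'} // v vs st st' l _ run IH /= /andP[v_vs uvs].
rewrite inE; have [-> _|neq_iv /= i_vs] := eqVneq i v => new_i.
  exists l => m; rewrite (greedy_run_notin run v_vs) greedy_put_in eqxx andbT.
  by rewrite (negbTE (new_i m)) orbF.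
apply: IH => // m.
by rewrite greedy_put_in (negbTE neq_iv) andbF new_i.
Qed.

Lemma greedy_output_kpartition (A : {ffun 'I_k -> {set 'I_n}}) :
  greedy_output f A -> kpartition A.
Proof.
case=> vs [s [[perm_vs _] run]]; apply: kpartition_label => i.
apply: (greedy_run_label run).
- by rewrite (perm_uniq perm_vs) enum_uniq.
- by rewrite (perm_mem perm_vs) mem_enum.
- by move=> l; rewrite ffunE inE.
Qed.

End Greedy.

(** Group the total by parts and square: the squares of the part sums form [sumsq], and the products
    across two parts are exactly the weights of the cut. *)
Lemma cut_sumsq (R : realType) (n k : nat) (G : wgraph R n) (f : 'I_n -> R)
    (A : {ffun 'I_k -> {set 'I_n}}) : rank1_features G f -> kpartition A ->
  cut G A *+ 2 + sumsq f A = (\sum_i f i) ^+ 2.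
Proof.
move=> rk1 [disjA covA].
have -> : \sum_i f i = \sum_l \sum_(i in A l) f i.
  rewrite -partition_disjoint_bigcup // covA.
  by apply: eq_bigl => i; rewrite in_setT.
rewrite sqr_sum_ord addrC; congr (_ + _ *+ 2).
apply: eq_bigr => l _; apply: eq_bigr => m lt_lm; rewrite big_distrlr /=.
apply: eq_bigr => i Ai; apply: eq_bigr => j Aj; rewrite rk1 //.
(* [rk1] speaks only of distinct vertices; [i] and [j] differ because they lie in disjoint parts. *)
apply: contraTneq Aj => <-; rewrite (disjointFr _ Ai) //.
by apply: disjA; rewrite -val_eqE /= ltn_eqF.
Qed.

Theorem proposition13 (R : realType) (n k : nat) (hk2 : (2 <= k)%N)
    (hkn : (k < n)%N) (G : wgraph R n) (f : 'I_n -> R)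
    (hf : forall i : 'I_n, 0 <= f i)
    (hG : rank1_features G f)
    (hw : forall i j : 'I_n, edge G i j -> 0 <= weight G i j)
    (Aalg Aopt : {ffun 'I_k -> {set 'I_n}})
    (halg : greedy_output f Aalg)
    (hopt : max_kcut G Aopt)
    (alpha : R) (halpha1 : 1 <= alpha)
    (halpha : greedy_sumsq_constant alpha) :
  cut G Aopt - cut G Aalg <= (alpha - 1) / (2 * alpha) * sumsq f Aalg.
Proof.
have [partopt maxopt] := hopt.
have cutE (B : {ffun 'I_k -> {set 'I_n}}) :
    kpartition B -> cut G B *+ 2 + sumsq f B = (\sum_i f i) ^+ 2.
  exact: cut_sumsq.
(* [halpha] compares the greedy value only with a minimizer of [sumsq], so [Aopt] must be shown to
   be one. *)
have minopt : min_sumsq f Aopt.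
  split=> // B partB; have := cutE _ partB; have := cutE _ partopt.
  by have := maxopt _ partB; rewrite !mulr2n; lra.
have bound := halpha _ _ _ _ _ (ltnW hk2) hf halg minopt.
have eopt := cutE _ partopt.
have ealg := cutE _ (greedy_output_kpartition halg).
have a_gt0 : 0 < alpha by apply: lt_le_trans halpha1.
(* In this form the bound is linear in [sumsq f Aalg] and [sumsq f Aalg / alpha], so [lra] can close
   the goal. *)
have -> : (alpha - 1) / (2 * alpha) * sumsq f Aalg =
    (sumsq f Aalg - sumsq f Aalg / alpha) / 2.
  by field; rewrite gt_eqF.
have : sumsq f Aalg / alpha <= sumsq f Aopt by rewrite ler_pdivrMr // mulrC.
by rewrite !mulr2n in eopt ealg; lra.
Qed.
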